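(* Consider a finite MDP with feature mapping $\mathbf{x}:\mathcal{S}\to\mathbb{R}^m$, discount $\gamma\in[0,1)$, a data-generating policy $b$, a policy $\pi$ to be evaluated, a search-control feature distribution $\zeta$, and an expectation model $\{\hat{\mathbf{x}},\hat r\}$. If 1. the Markov chain induced by $b$ is ergodic and $\mathbb{E}_\zeta[\boldsymbol\phi_k\boldsymbol\phi_k^\top]$ is non-singular, 2. $\zeta=\mu$, the stationary feature-vector distribution of $b$, 3. $\hat{\mathbf{x}}=\hat{\mathbf{x}}^*$ and $\hat r=\hat r^*$ (the best non-linear expectation model for data generated by $b$), then $\text{MB-MSPBE}(\mathbf{w})=\text{MSPBE}(\mathbf{w})$ (for every $\mathbf{w}\in\mathbb{R}^m$).
   Context: The MDP has finite state, action and reward sets $\mathcal{S},\mathcal{A},\mathcal{R}$ and dynamics $p(s',r\mid s,a)=\Pr(S_{t+1}=s',R_{t+1}=r\mid S_t=s,A_t=a)$. Write $\mathbf{x}_t=\mathbf{x}(S_t)$. Policies depend on the state only through its feature vector: $b(a\mid\boldsymbol\phi)$, $\pi(a\mid\boldsymbol\phi)$. Let $\eta$ be the unique stationary state distribution of the (ergodic) chain induced by $b$. $\mathbb{E}_b[\cdot]$ denotes expectation with $S_t\sim\eta$, $A_t\sim b(\cdot\mid\mathbf{x}_t)$, $(S_{t+1},R_{t+1})\sim p(\cdot,\cdot\mid S_t,A_t)$. For a feature vector $\boldsymbol\phi$, $H_{\boldsymbol\phi}=\{s\in\mathcal{S}:\mathbf{x}(s)=\boldsymbol\phi\}$ and $\mu(\boldsymbol\phi)=\sum_{s\in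 H_{\boldsymbol\phi}}\eta(s)$. $\mathbb{E}_\zeta[\cdot]$ denotes expectation with $\boldsymbol\phi_k\sim\zeta$, $A_k\sim\pi(\cdot\mid\boldsymbol\phi_k)$. $\rho_t=\pi(A_t\mid\mathbf{x}_t)/b(A_t\mid\mathbf{x}_t)$ is the importance sampling ratio. An expectation model is a pair of functions $\hat{\mathbf{x}}(\boldsymbol\phi,a)\in\mathbb{R}^m$, $\hat r(\boldsymbol\phi,a)\in\mathbb{R}$. The best non-linear expectation model is $\hat{\mathbf{x}}^*(\boldsymbol\phi,a)=\mathbb{E}_b[\mathbf{x}_{t+1}\mid\mathbf{x}_t=\boldsymbol\phi,A_t=a]=\frac{1}{\mu(\boldsymbol\phi)}\sum_{s\in H_{\boldsymbol\phi}}\eta(s)\,\mathbb{E}_b[\mathbf{x}(S_{t+1})\mid S_t=s,A_t=a]$ and $\hat r^*(\boldsymbol\phi,a)=\mathbb{E}_b[R_{t+1}\mid\mathbf{x}_t=\boldsymbol\phi,A_t=a]=\frac{1}{\mu(\boldsymbol\phi)}\sum_{s\in H_{\boldsymbol\phi}}\eta(s)\,\mathbb{E}_b[R_{t+1}\mid S_t=s,A_t=a]$. For $\mathbf{w}\in\mathbb{R}^m$ let $\Delta_k=\hat r(\boldsymbol\phi_k,A_k)+\gamma\mathbf{w}^\top\hat{\mathbf{x}}(\boldsymbol\phi_k,A_k)-\mathbf{w}^\top\boldsymbol\phi_k$ and $\delta_t=R_{t+1}+\gamma\mathbf{w}^\top\mathbf{x}_{t+1}-\mathbf{w}^\top\mathbf{x}_t$.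 Define $\text{MB-MSPBE}(\mathbf{w})=\mathbb{E}_\zeta[\Delta_k\boldsymbol\phi_k]^\top\,\mathbb{E}_\zeta[\boldsymbol\phi_k\boldsymbol\phi_k^\top]^{-1}\,\mathbb{E}_\zeta[\Delta_k\boldsymbol\phi_k]$ and $\text{MSPBE}(\mathbf{w})=\mathbb{E}_b[\rho_t\delta_t\mathbf{x}_t]^\top\,\mathbb{E}_b[\mathbf{x}_t\mathbf{x}_t^\top]^{-1}\,\mathbb{E}_b[\rho_t\delta_t\mathbf{x}_t]$.
   Formalization: The formal theorem adds the coverage assumption that b(a|x(s)) > 0 whenever π(a|x(s)) > 0; without it the claim fails, e.g. one state with x = 1, γ = 0, w = 0, b always taking an action of reward 0 and π always one of reward 1. *)

(* Defs.v *)
From HB Require Import structures.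
From mathcomp Require Import all_boot all_order all_algebra finmap.
Set Implicit Arguments.
Unset Strict Implicit.
Unset Printing Implicit Defensive.
Import Order.TTheory GRing.Theory Num.Theory.
Local Open Scope ring_scope.

Definition is_pmf (R : realFieldType) (T : finType) (q : T -> R) : Prop :=
  (forall t, 0 <= q t) /\ \sum_t q t = 1.

(* Finitely supported probability mass functions on a possibly infinite type. *)
Definition is_fspmf (R : realFieldType) (T : choiceType)
    (q : {fsfun T -> R with 0}) : Prop :=
  (forall t, 0 <= q t) /\ \sum_(t <- finsupp q) q t = 1.

Record mdp (R : realFieldType) (S A : finType) := MDP {
  rewards : {fset R};
  dynamics : S -> A -> S -> rewards -> R;
  dynamics_ge0 : forall s a s' r, 0 <= dynamics s a s' r;
  dynamics_sum1 : forall s a, \sum_s' \sum_r dynamics s a s' r = 1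
}.
Arguments dynamics {R S A} m s a s' r.

Section MarkovChain.
Variables (R : realFieldType) (S : finType) (P : S -> S -> R).

Fixpoint nstep (n : nat) (s s' : S) : R :=
  if n is k.+1 then \sum_u P s u * nstep k u s' else (s == s')%:R.

Definition irreducible : Prop := forall s s', exists n, 0 < nstep n s s'.

(* The gcd of the return times to s is 1, for every s. *)
Definition aperiodic : Prop := forall (s : S) (d : nat),
  (forall n, (0 < n)%N -> 0 < nstep n s s -> (d %| n)%N) -> d = 1%N.

Definition ergodic : Prop := irreducible /\ aperiodic.

Definition is_stationary (eta : S -> R) : Prop :=
  is_pmf eta /\ forall s', \sum_s eta s * P s s' = eta s'.

End MarkovChain.

Section Expectations.
Variables (R : realFieldType) (S A : finType) (M : mdp R S A) (m : nat).
Variable x : S -> 'cV[R]_m.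
Implicit Types (b pi : 'cV[R]_m -> A -> R) (eta : S -> R) (V : lmodType R).

Definition is_policy b : Prop := forall phi, is_pmf (b phi).

Definition transition b (s s' : S) : R :=
  \sum_a b (x s) a * \sum_r dynamics M s a s' r.

(* E_b[g(S_{t+1}, R_{t+1}) | S_t = s, A_t = a] *)
Definition E_step V (s : S) (a : A) (g : S -> R -> V) : V :=
  \sum_s' \sum_r dynamics M s a s' r *: g s' (val r).

(* E_b[f(S_t, A_t, S_{t+1}, R_{t+1})] *)
Definition E_b V b eta (f : S -> A -> S -> R -> V) : V :=
  \sum_s eta s *: \sum_a b (x s) a *: E_step s a (f s a).

(* Pr_b(x_t = phi, A_t = a) *)
Definition prob_b b eta (phi : 'cV[R]_m) (a : A) : R :=
  E_b (V := R^o) b eta (fun s a' _ _ => ((x s == phi) && (a' == a))%:R).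

(* E_b[f(S_t, A_t, S_{t+1}, R_{t+1}) | x_t = phi, A_t = a];
   meaningful only when 0 < prob_b b eta phi a. *)
Definition E_b_cond V b eta (phi : 'cV[R]_m) (a : A)
    (f : S -> A -> S -> R -> V) : V :=
  (prob_b b eta phi a)^-1 *:
    E_b b eta (fun s a' s' r => ((x s == phi) && (a' == a))%:R *: f s a' s' r).

Definition best_xhat b eta (phi : 'cV[R]_m) (a : A) : 'cV[R]_m :=
  E_b_cond b eta phi a (fun _ _ s' _ => x s').

Definition best_rhat b eta (phi : 'cV[R]_m) (a : A) : R :=
  E_b_cond (V := R^o) b eta phi a (fun _ _ _ r => r).

(* The stationary feature distribution: phi |-> sum of eta over H_phi. *)
Definition mu eta : {fsfun 'cV[R]_m -> R with 0} :=
  [fsfun phi in [fset x s | s in S]%fset => \sum_(s | x s == phi) eta s | 0].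

(* E_zeta[f(phi_k, A_k)] *)
Definition E_zeta V (zeta : {fsfun 'cV[R]_m -> R with 0}) pi
    (f : 'cV[R]_m -> A -> V) : V :=
  \sum_(phi <- finsupp zeta) zeta phi *: \sum_a pi phi a *: f phi a.

Definition dot (u v : 'cV[R]_m) : R := (u^T *m v) 0 0.

Definition quad_inv (C : 'M[R]_m) (u : 'cV[R]_m) : R :=
  (u^T *m invmx C *m u) 0 0.

Definition model_td (gamma : R) (xhat : 'cV[R]_m -> A -> 'cV[R]_m)
    (rhat : 'cV[R]_m -> A -> R) (w phi : 'cV[R]_m) (a : A) : R :=
  rhat phi a + gamma * dot w (xhat phi a) - dot w phi.

Definition sample_td (gamma : R) (w : 'cV[R]_m) (s s' : S) (r : R) : R :=
  r + gamma * dot w (x s') - dot w (x s).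

Definition rho b pi (s : S) (a : A) : R := pi (x s) a / b (x s) a.

Definition MB_MSPBE zeta pi (gamma : R) xhat rhat (w : 'cV[R]_m) : R :=
  quad_inv (E_zeta zeta pi (fun phi _ => phi *m phi^T))
    (E_zeta zeta pi
       (fun phi a => model_td gamma xhat rhat w phi a *: phi)).

Definition MSPBE b eta pi (gamma : R) (w : 'cV[R]_m) : R :=
  quad_inv (E_b b eta (fun s _ _ _ => x s *m (x s)^T))
    (E_b b eta
       (fun s a s' r => (rho b pi s a * sample_td gamma w s s' r) *: x s)).

Lemma muE eta phi : mu eta phi = \sum_(s | x s == phi) eta s.
Proof.
rewrite /mu fsfunE; case: ifP => // /negbT xN.
rewrite big1 // => s /eqP xs; case/negP: xN; apply/imfsetP; exists s => //.
Qed.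

Lemma prob_bE b eta phi a : prob_b b eta phi a = mu eta phi * b phi a.
Proof.
rewrite muE /prob_b /E_b mulr_suml [RHS]big_mkcond /=.
apply: eq_bigr => s _; rewrite /E_step; case: eqP => [xs|_] /=; last first.
  rewrite big1 ?scaler0 // => a' _; rewrite big1 ?scaler0 // => s' _.
  by rewrite big1 // => r _; rewrite scaler0.
rewrite (bigD1 a) //= [X in _ + X]big1 ?addr0; last first.
  move=> a' /negPf ->; rewrite big1 ?scaler0 // => s' _.
  by rewrite big1 // => r _; rewrite scaler0.
rewrite eqxx xs (_ : \sum_s' _ = 1) /GRing.scale /= ?mulr1 //.
rewrite -[RHS](dynamics_sum1 M s a); apply: eq_bigr => s' _.
by apply: eq_bigr => r _; exact: mulr1.
Qed.

(* Conditional expectations given x_t = phi, A_t = a are eta-averages over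
   H_phi of the conditional expectations given S_t = s, A_t = a. *)
Lemma E_b_condE V b eta phi a (g : S -> R -> V) :
  0 < prob_b b eta phi a ->
  E_b_cond b eta phi a (fun _ _ => g) =
  (mu eta phi)^-1 *: \sum_(s | x s == phi) eta s *: E_step s a g.
Proof.
rewrite /E_b_cond prob_bE => mub_gt0.
have b0 : b phi a != 0 by apply: contraTneq mub_gt0 => ->; rewrite mulr0 ltxx.
rewrite invfM -scalerA; congr (_ *: _).
suff -> : E_b b eta (fun s a' s' r => ((x s == phi) && (a' == a))%:R *: g s' r)
    = b phi a *: \sum_(s | x s == phi) eta s *: E_step s a g.
  by rewrite scalerA mulVf // scale1r.
rewrite scaler_sumr [RHS]big_mkcond /=; apply: eq_bigr => s _.
rewrite /E_step; case: eqP => [xs|_] /=; last first.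
  rewrite big1 ?scaler0 // => a' _; rewrite big1 ?scaler0 // => s' _.
  by rewrite big1 // => r _; rewrite scale0r scaler0.
rewrite (bigD1 a) //= [X in _ + X]big1 ?addr0; last first.
  move=> a' /negPf ->; rewrite big1 ?scaler0 // => s' _.
  by rewrite big1 // => r _; rewrite scale0r scaler0.
rewrite eqxx xs !scalerA mulrC; congr (_ *: _); apply: eq_bigr => s' _.
by apply: eq_bigr => r _; rewrite scale1r.
Qed.

End Expectations.

(* Main.v *)
(* Both losses are quadratic forms in a correction vector and a feature
   covariance matrix.  Importance sampling turns the action weights b into pi,
   and averaging the expected one-step TD error over the states of H_phi gives
   mu(phi) times the TD error of the best expectation model, because the TD
   error is affine in (x_{t+1}, R_{t+1}).  Summing over phi identifies the two
   vectors, and likewise the two matrices. *)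

Require Import Defs.
From HB Require Import structures.
From mathcomp Require Import all_boot all_order all_algebra finmap.
Set Implicit Arguments.
Unset Strict Implicit.
Unset Printing Implicit Defensive.
Import Order.TTheory GRing.Theory Num.Theory.
Local Open Scope ring_scope.

Section Step.
Variables (R : realFieldType) (S A : finType) (M : mdp R S A) (m : nat).
Variable x : S -> 'cV[R]_m.

(** The codomain is [R^o] so that [dot w] becomes a linear map between modules and commutes with
    expectations. *)
Lemma dot_is_linear (w : 'cV[R]_m) : linear (dot w : 'cV[R]_m -> R^o).
Proof. by move=> c u v; rewrite /dot mulmxDr -scalemxAr !mxE. Qed.

HB.instance Definition _ (w : 'cV[R]_m) :=
  GRing.isLinear.Build R 'cV[R]_m R^o *:%R (dot w) (dot_is_linear w).

Lemma dotZ (w : 'cV[R]_m) c v : dot w (c *: v) = c * dot w v.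
Proof. by rewrite linearZ. Qed.

Lemma E_step_linear (V W : lmodType R) (f : {linear V -> W}) s a
    (g : S -> R -> V) :
  E_step M s a (fun s' r => f (g s' r)) = f (E_step M s a g).
Proof.
rewrite /E_step linear_sum; apply: eq_bigr => s' _.
by rewrite linear_sum; apply: eq_bigr => r _; rewrite linearZ.
Qed.

Lemma E_stepD (V : lmodType R) s a (g h : S -> R -> V) :
  E_step M s a (fun s' r => g s' r + h s' r) = E_step M s a g + E_step M s a h.
Proof.
rewrite /E_step -big_split; apply: eq_bigr => s' _.
by rewrite -big_split; apply: eq_bigr => r _; rewrite scalerDr.
Qed.

Lemma E_step_cst (V : lmodType R) s a (v : V) :
  E_step M s a (fun _ _ => v) = v.
Proof.
rewrite -[RHS]scale1r -(dynamics_sum1 M s a) scaler_suml.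
by apply: eq_bigr => s' _; rewrite scaler_suml.
Qed.

Lemma E_step_scalel (V : lmodType R) s a (g : S -> R -> R) (v : V) :
  E_step M s a (fun s' r => g s' r *: v) =
  (E_step M s a (g : S -> R -> R^o) : R) *: v.
Proof.
rewrite /E_step scaler_suml; apply: eq_bigr => s' _.
by rewrite scaler_suml; apply: eq_bigr => r _; rewrite scalerA.
Qed.

(** The mean TD error from [s] under [a], shaped like [model_td] with the state-level means of
    reward and next features in place of the model. *)
Definition expected_td gamma (w : 'cV[R]_m) s a : R :=
  E_step M s a (fun _ r => r : R^o)
  + gamma * dot w (E_step M s a (fun s' _ => x s')) - dot w (x s).

Lemma E_step_td gamma w s a :
  E_step M s a (sample_td x gamma w s : S -> R -> R^o) = expected_td gamma w s a.
Proof.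
rewrite /sample_td /expected_td !E_stepD E_step_cst; congr (_ + _ - _).
by rewrite (E_step_linear (gamma \*: (dot w : {linear _ -> R^o}))).
Qed.

Lemma E_step_rho_td gamma w b pi s a :
  E_step M s a
    (fun s' r => (rho x b pi s a * sample_td x gamma w s s' r) *: x s) =
  (rho x b pi s a * expected_td gamma w s a) *: x s.
Proof.
rewrite E_step_scalel -E_step_td; congr (_ *: _).
(* The ratio depends on [s] and [a] only, so it acts as a constant scaling of the step. *)
exact: (E_step_linear (rho x b pi s a \*: (idfun : {linear R^o -> R^o}))).
Qed.

End Step.

Section FeatureAverage.
Variables (R : realFieldType) (S A : finType) (m : nat).
Variables (x : S -> 'cV[R]_m) (eta : S -> R).
Hypothesis eta_ge0 : forall s, 0 <= eta s.

Lemma mu_ge0 phi : 0 <= mu x eta phi.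
Proof. by rewrite muE sumr_ge0. Qed.

Lemma mu_eq0_eta s : mu x eta (x s) = 0 -> eta s = 0.
Proof.
by rewrite muE => /eqP; rewrite psumr_eq0 // => /allP/(_ s (mem_index_enum _));
  rewrite eqxx => /eqP.
Qed.

(** Grouping states by feature vector loses nothing: a feature outside the support of [mu] has only
    states of [eta]-weight zero, by [mu_eq0_eta]. *)
Lemma sum_by_feature (V : lmodType R) (F : S -> V) :
  \sum_s eta s *: F s =
  \sum_(phi <- finsupp (mu x eta)) \sum_(s | x s == phi) eta s *: F s.
Proof.
rewrite (exchange_big_dep xpredT) //=; apply: eq_bigr => s _.
case: (boolP (x s \in finsupp (mu x eta))) => [xs|].
  rewrite big_mkcond (bigD1_seq (x s)) ?fset_uniq //= eqxx big1 ?addr0 // => phi.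
  by rewrite eq_sym => /negPf ->.
rewrite memNfinsupp => /eqP/mu_eq0_eta ->; rewrite scale0r.
by rewrite big1 // => phi _; rewrite scale0r.
Qed.

(** [pi] is constant on each fibre H_phi, so the action average and the fibre average can be
    exchanged. The hypothesis is restricted to pairs of nonzero weight because the model is
    prescribed only at pairs that [b] visits. *)
Lemma E_zeta_mu (V : lmodType R) (pi : 'cV[R]_m -> A -> R)
    (f : 'cV[R]_m -> A -> V) (F : S -> A -> V) :
  (forall phi a, mu x eta phi != 0 -> pi phi a != 0 ->
     mu x eta phi *: f phi a = \sum_(s | x s == phi) eta s *: F s a) ->
  E_zeta (mu x eta) pi f = \sum_s eta s *: \sum_a pi (x s) a *: F s a.
Proof.
move=> fF; rewrite sum_by_feature; apply: eq_big_seq => phi.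
rewrite mem_finsupp => mu0.
have -> : \sum_(s | x s == phi) eta s *: (\sum_a pi (x s) a *: F s a) =
    \sum_a pi phi a *: \sum_(s | x s == phi) eta s *: F s a.
  under [RHS]eq_bigr do rewrite scaler_sumr.
  rewrite exchange_big; apply: eq_bigr => s /eqP ->.
  by rewrite scaler_sumr; apply: eq_bigr => a _; rewrite !scalerA mulrC.
rewrite scaler_sumr; apply: eq_bigr => a _.
have [->|pi0] := eqVneq (pi phi a) 0; first by rewrite !scale0r scaler0.
by rewrite -fF // !scalerA mulrC.
Qed.

End FeatureAverage.

Section Model.
Variables (R : realFieldType) (S A : finType) (M : mdp R S A) (m : nat).
Variables (x : S -> 'cV[R]_m) (eta : S -> R) (b : 'cV[R]_m -> A -> R).

(** A pair of positive probability has nonzero [mu], which cancels the normalisation. *)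
Lemma mu_E_b_cond (V : lmodType R) phi a (g : S -> R -> V) :
  0 < prob_b M x b eta phi a ->
  mu x eta phi *: E_b_cond M x b eta phi a (fun _ _ => g) =
  \sum_(s | x s == phi) eta s *: E_step M s a g.
Proof.
move=> p0; rewrite E_b_condE // scalerA mulfV ?scale1r //.
by apply: contraTneq p0; rewrite prob_bE => ->; rewrite mul0r ltxx.
Qed.

Lemma mu_best_model_td gamma w phi a :
  0 < prob_b M x b eta phi a ->
  mu x eta phi * model_td gamma (best_xhat M x b eta) (best_rhat M x b eta)
                   w phi a =
  \sum_(s | x s == phi) eta s * expected_td M x gamma w s a.
Proof.
move=> p0; rewrite /model_td mulrBr mulrDr (mulrCA _ gamma).
have -> : mu x eta phi * best_rhat M x b eta phi a =
    \sum_(s | x s == phi) eta s * E_step M s a (fun _ r => r : R^o).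
  exact: (mu_E_b_cond (V := R^o) (fun _ r => r)).
have -> : mu x eta phi * dot w (best_xhat M x b eta phi a) =
    \sum_(s | x s == phi) eta s * dot w (E_step M s a (fun s' _ => x s')).
  rewrite -dotZ mu_E_b_cond // linear_sum.
  by apply: eq_bigr => s _; rewrite /= dotZ.
(* The remaining term [dot w phi] equals [dot w (x s)] throughout H_phi, so it too becomes a sum
   over the fibre. *)
rewrite muE mulr_sumr mulr_suml -big_split -sumrB; apply: eq_bigr => s /eqP xs.
by rewrite /expected_td xs mulrBr mulrDr (mulrCA gamma).
Qed.

End Model.

Theorem proposition6p1 (R : realFieldType) (S A : finType) (M : mdp R S A)
  (m : nat) (x : S -> 'cV[R]_m) (gamma : R)
  (b pi : 'cV[R]_m -> A -> R) (eta : S -> R)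
  (zeta : {fsfun 'cV[R]_m -> R with 0})
  (xhat : 'cV[R]_m -> A -> 'cV[R]_m) (rhat : 'cV[R]_m -> A -> R)
  (gamma_range : 0 <= gamma < 1)
  (b_policy : is_policy b) (pi_policy : is_policy pi)
  (coverage : forall s a, 0 < pi (x s) a -> 0 < b (x s) a)
  (zeta_pmf : is_fspmf zeta)
  (b_ergodic : ergodic (transition M x b))
  (eta_stationary : is_stationary (transition M x b) eta)
  (zeta_nonsing : E_zeta zeta pi (fun phi _ => phi *m phi^T) \in unitmx)
  (zeta_mu : zeta = mu x eta)
  (xhat_best : forall phi a, 0 < prob_b M x b eta phi a ->
     xhat phi a = best_xhat M x b eta phi a)
  (rhat_best : forall phi a, 0 < prob_b M x b eta phi a ->
     rhat phi a = best_rhat M x b eta phi a) :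
  forall w : 'cV[R]_m,
    MB_MSPBE zeta pi gamma xhat rhat w = MSPBE M x b eta pi gamma w.
Proof.
move=> w; have eta0 := eta_stationary.1.1.
rewrite /MB_MSPBE /MSPBE zeta_mu; congr quad_inv.
  rewrite (E_zeta_mu eta0 (F := fun s _ => x s *m (x s)^T)); last first.
    by move=> phi a _ _; rewrite muE scaler_suml; apply: eq_bigr => s /eqP ->.
  apply: eq_bigr => s _; congr (_ *: _).
  under [RHS]eq_bigr do rewrite E_step_cst.
  (* The integrand ignores the action, so both policies contribute total mass 1. *)
  by rewrite -!scaler_suml (pi_policy _).2 (b_policy _).2.
rewrite (E_zeta_mu eta0 (F := fun s a => expected_td M x gamma w s a *: x s)).
  apply: eq_bigr => s _; congr (_ *: _); apply: eq_bigr => a _.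
  rewrite E_step_rho_td /rho !scalerA mulrA mulrCA; congr (_ * _ *: _).
  (* Where [b] vanishes the ratio does not cancel, but coverage makes [pi] vanish there too. *)
  have [b0|b0] := eqVneq (b (x s) a) 0; last by rewrite mulfV ?mulr1.
  rewrite b0 mul0r mulr0; apply: contra_eq b0 => pi0.
  by rewrite gt_eqF // coverage // lt0r pi0 (pi_policy _).1.
move=> phi a mu0 pi0.
have p0 : 0 < prob_b M x b eta phi a.
  have mu_gt0 : 0 < mu x eta phi by rewrite lt0r mu0 mu_ge0.
  rewrite prob_bE pmulr_rgt0 //.
  (* Coverage speaks of states, so a state in H_phi is needed; an empty fibre would give [mu] the
     value 0. *)
  have [s /eqP xs|no_s] := pickP (fun s => x s == phi).
    by rewrite -xs coverage // xs lt0r pi0 (pi_policy _).1.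
  by rewrite muE big_pred0 ?eqxx in mu0.
rewrite /model_td xhat_best // rhat_best // scalerA.
(* The models agree at this pair only, so the TD error was rewritten pointwise and is now folded
   back. *)
rewrite -[_ + _ - _]/(model_td _ (best_xhat M x b eta) (best_rhat M x b eta) _ _ _).
rewrite mu_best_model_td // scaler_suml.
by apply: eq_bigr => s /eqP ->; rewrite scalerA.
Qed.
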